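(* Let $\mathcal U$ be a unitary 2-design on $\mathcal H$, let $\rho$ be a density operator on $\mathcal H$ and let $O$ be a traceless Hermitian operator on $\mathcal H$. Let $\mathcal E(O)=\{WOW^\dagger: W\in U(d)\}$ and $\mathcal E(\rho)=\{W\rho W^\dagger: W\in U(d)\}$, each equipped with the measure induced by the Haar measure on $W$. Write $V(\mathcal E(O),\rho)=\mathbb E_{W\sim\mathrm{Haar}}V(WOW^\dagger,\rho)$ and $V(O,\mathcal E(\rho))=\mathbb E_{W\sim\mathrm{Haar}}V(O,W\rho W^\dagger)$; define $V_*(\mathcal E(O),\rho)$ and $V_*(O,\mathcal E(\rho))$ analogously. Then $$V(\mathcal E(O),\rho)=V(O,\mathcal E(\rho))=\Bigl(1+\frac{d-\wp}{d^2-1}\Bigr)\|O\|_2^2,$$ $$V_*(\mathcal E(O),\rho)=V_*(O,\mathcal E(\rho))=\frac{d\wp-1}{d^2-1}\|O\|_2^2<\frac{\|O\|_2^2}{d},$$ where $\wp=\operatorname{tr}(\rho^2)$.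
   Context: Let $n\ge1$, $d=2^n$, and $\mathcal H=(\mathbb C^2)^{\otimes n}$ with computational basis $\{|\mathbf b\rangle\}_{\mathbf b\in\{0,1\}^n}$. A unitary ensemble $\mathcal U$ is a probability distribution on $U(d)$. Its measurement channel is $\mathcal M(X)=\mathbb E_{U\sim\mathcal U}\sum_{\mathbf b}\langle\mathbf b|UXU^\dagger|\mathbf b\rangle\,U^\dagger|\mathbf b\rangle\langle\mathbf b|U$, assumed invertible (for a unitary 2-design, $\mathcal M^{-1}(O)=(d+1)O-\operatorname{tr}(O)\mathbb 1$). For a density operator $\rho$ and a traceless Hermitian operator $O$ define $V(O,\rho)=\mathbb E_{U\sim\mathcal U}\sum_{\mathbf b}\langle\mathbf b|U\rho U^\dagger|\mathbf b\rangle\bigl(\langle\mathbf b|U\mathcal M^{-1}(O)U^\dagger|\mathbf b\rangle\bigr)^2-[\operatorname{tr}(O\rho)]^2$ (the single-shot classical-shadow variance) and $V_*(O,\rho)=\mathbb E_{U\sim\mathcal U}\bigl(\sum_{\mathbf b}\langle\mathbf b|U\rho U^\dagger|\mathbf b\rangle\langle\mathbf b|U\mathcal M^{-1}(O)U^\dagger|\mathbf b\rangle\bigr)^2-[\operatorname{tr}(O\rho)]^2$ (the thrifty-shadow overhead term; reusing each sampled unitary $R$ times gives variance $V/R+(R-1)V_*/R$). $\|O\|_2$ is the Hilbert–Schmidt norm.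
   Formalization: The strict inequality V_* < ||O||_2^2/d is stated only for O ≠ 0, since for O = 0 both sides are 0 and it fails; the four equalities are stated for every traceless Hermitian O. *)

(* Defs.v *)
From HB Require Import structures.
From mathcomp Require Import all_boot all_order all_algebra.
From mathcomp Require Import all_classical all_reals all_analysis.
From mathcomp Require Import complex.
Set Implicit Arguments.
Unset Strict Implicit.
Unset Printing Implicit Defensive.
Import Order.TTheory GRing.Theory Num.Theory.
Import numFieldNormedType.Exports.
Local Open Scope ring_scope.

Section Shadows.
Context (R : realType).
Local Notation C := (R[i]).

Definition adj {m k : nat} (A : 'M[C]_(m, k)) : 'M[C]_(k, m) :=
  map_mx Num.conj (A ^T).

Definition hermitian_op {m : nat} (A : 'M[C]_m) : Prop := adj A = A.

Definition unitary {m : nat} (U : 'M[C]_m) : Prop := U *m adj U = 1%:M.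

Definition density {m : nat} (rho : 'M[C]_m) : Prop :=
  [/\ hermitian_op rho,
      (forall v : 'cV[C]_m, 0 <= (adj v *m rho *m v) 0 0)
    & \tr rho = 1].

Definition hs_norm2 {m : nat} (O : 'M[C]_m) : C := \tr (adj O *m O).

Definition Ex {dT : measure_display} {T : measurableType dT}
  (P : probability T R) (f : T -> C) : C :=
  ((Rintegral P setT (fun t => complex.Re (f t)))%:C)%C
  + 'i * ((Rintegral P setT (fun t => complex.Im (f t)))%:C)%C.

(** A random unitary on a probability space (T, P): a map U : T -> U(m)
    whose matrix entries are measurable.  Its law is a unitary ensemble
    (a probability distribution on U(m)). *)
Definition random_unitary {m : nat} {dT : measure_display}
  {T : measurableType dT} (U : T -> 'M[C]_m) : Prop :=
  (forall t, unitary (U t)) /\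
  (forall i j, measurable_fun setT (fun t => complex.Re (U t i j)) /\
               measurable_fun setT (fun t => complex.Im (U t i j))).

Definition monomial {m : nat} (A : 'M[C]_m) (s s' : seq ('I_m * 'I_m)) : C :=
  (\prod_(p <- s) A p.1 p.2) * (\prod_(p <- s') Num.conj (A p.1 p.2)).

(** W is Haar distributed: its law is left-invariant under every fixed unitary
    V, i.e. V W and W have the same law.  Since the law is supported on the
    compact set U(m), it is determined by its mixed moments, so equality in law
    is expressed as equality of all mixed moments of the entries. *)
Definition haar {m : nat} {dT : measure_display} {T : measurableType dT}
  (Q : probability T R) (W : T -> 'M[C]_m) : Prop :=
  random_unitary W /\
  forall V : 'M[C]_m, unitary V ->
  forall s s' : seq ('I_m * 'I_m),
    Ex Q (fun x => monomial (V *m W x) s s') = Ex Q (fun x => monomial (W x) s s').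

(** The ensemble of U is a unitary 2-design: its moments of degree (2,2)
    (E[U^{(x)2} (x) conj(U)^{(x)2}]) agree with those of the Haar measure. *)
Definition two_design {m : nat}
  {dT : measure_display} {T : measurableType dT} (P : probability T R)
  (U : T -> 'M[C]_m)
  {dS : measure_display} {S : measurableType dS} (Q : probability S R)
  (W : S -> 'M[C]_m) : Prop :=
  random_unitary U /\
  forall s s' : seq ('I_m * 'I_m), size s = 2%N -> size s' = 2%N ->
    Ex P (fun t => monomial (U t) s s') = Ex Q (fun x => monomial (W x) s s').

Definition meas_channel {m : nat} {dT : measure_display} {T : measurableType dT}
  (P : probability T R) (U : T -> 'M[C]_m) (X : 'M[C]_m) : 'M[C]_m :=
  \matrix_(k, l) Ex P (fun t =>
     \sum_(b < m) (U t *m X *m adj (U t)) b b *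
        (adj (U t) *m delta_mx b b *m U t) k l).

Definition shadow_var {m : nat} {dT : measure_display} {T : measurableType dT}
  (P : probability T R) (U : T -> 'M[C]_m) (Minv : 'M[C]_m -> 'M[C]_m)
  (O rho : 'M[C]_m) : C :=
  Ex P (fun t => \sum_(b < m) (U t *m rho *m adj (U t)) b b *
                   ((U t *m Minv O *m adj (U t)) b b) ^+ 2)
  - (\tr (O *m rho)) ^+ 2.

Definition thrifty_var {m : nat} {dT : measure_display} {T : measurableType dT}
  (P : probability T R) (U : T -> 'M[C]_m) (Minv : 'M[C]_m -> 'M[C]_m)
  (O rho : 'M[C]_m) : C :=
  Ex P (fun t => (\sum_(b < m) (U t *m rho *m adj (U t)) b b *
                   (U t *m Minv O *m adj (U t)) b b) ^+ 2)
  - (\tr (O *m rho)) ^+ 2.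

End Shadows.

(* Main.v *)
(** Let [t i j k l] be the Haar average of [(W A W')_ij (W B W')_kl], where
    [W' = adj W].  It is invariant under conjugation by unitaries.  Diagonal
    phases kill [t] unless the multisets {i, k} and {j, l} agree, permutations
    make the surviving entries constant, and a square root of a transposition
    gives [t a a a a = t a a b b + t a b b a].  Hence
    [t i j k l = alpha [i = j][k = l] + beta [i = l][j = k]], where the traces
    of [A], [B] and [A B] determine [alpha] and [beta].  A 2-design shares these
    moments, so its channel is [X |-> (X + tr X) / (d + 1)].  In each of the
    four averages, left invariance absorbs [U] into [W]; averaging over [W]
    first leaves moments of [U] of degree at most (2,2).  The final bound
    reduces to [tr rho^2 <= 1]. *)
Require Import Defs.
From HB Require Import structures.
From mathcomp Require Import all_boot all_order all_algebra.
From mathcomp Require Import all_classical all_reals all_analysis.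
From mathcomp Require Import measurable_realfun.
From mathcomp Require Import fingroup perm complex ring.
Import Order.TTheory GRing.Theory Num.Theory.
Local Open Scope ring_scope.
Set Implicit Arguments.
Unset Strict Implicit.

(** * Expectations of bounded measurable complex functions *)

Section Expectation.
Context (R : realType) (dT : measure_display) (T : measurableType dT).
Context (P : probability T R).
Local Notation C := (R[i]).
Implicit Types (f g : T -> C) (c : C).

(** On a probability space boundedness gives integrability and, unlike integrability, survives
    products. The class therefore contains every polynomial in the entries of a random unitary and
    their conjugates. *)
Definition bounded_mfun f : Prop :=
  [/\ measurable_fun setT (fun t => complex.Re (f t)),
      measurable_fun setT (fun t => complex.Im (f t))
    & exists M : C, forall t, `|f t| <= M].

Lemma ReM (x y : C) : complex.Re (x * y) =
  complex.Re x * complex.Re y - complex.Im x * complex.Im y.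
Proof. by case: x y => [a b] [c e]. Qed.

Lemma ImM (x y : C) : complex.Im (x * y) =
  complex.Re x * complex.Im y + complex.Im x * complex.Re y.
Proof. by case: x y => [a b] [c e]. Qed.

Lemma ReD (x y : C) : complex.Re (x + y) = complex.Re x + complex.Re y.
Proof. by case: x y => [a b] [c e]. Qed.

Lemma ImD (x y : C) : complex.Im (x + y) = complex.Im x + complex.Im y.
Proof. by case: x y => [a b] [c e]. Qed.

Lemma bounded_mfun_cst c : bounded_mfun (fun=> c).
Proof. by split; [exact: measurable_cst|exact: measurable_cst|exists `|c|]. Qed.

Lemma bounded_mfunD f g :
  bounded_mfun f -> bounded_mfun g -> bounded_mfun (fun t => f t + g t).
Proof.
move=> [rf jf [M hM]] [rg jg [N hN]]; split.
- under eq_fun do rewrite ReD; exact: measurable_funD.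
- under eq_fun do rewrite ImD; exact: measurable_funD.
- by exists (M + N) => t; rewrite (le_trans (ler_normD _ _))// lerD.
Qed.

Lemma bounded_mfunM f g :
  bounded_mfun f -> bounded_mfun g -> bounded_mfun (fun t => f t * g t).
Proof.
move=> [rf jf [M hM]] [rg jg [N hN]]; split.
- under eq_fun do rewrite ReM.
  by apply: measurable_funB; exact: measurable_funM.
- under eq_fun do rewrite ImM.
  by apply: measurable_funD; exact: measurable_funM.
- by exists (M * N) => t; rewrite normrM ler_pM.
Qed.

Lemma bounded_mfunZ c f : bounded_mfun f -> bounded_mfun (fun t => c * f t).
Proof. by move=> hf; apply: bounded_mfunM => //; exact: bounded_mfun_cst. Qed.

Lemma bounded_mfun_conj f :
  bounded_mfun f -> bounded_mfun (fun t => Num.conj (f t)).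
Proof.
move=> [rf jf [M hM]]; split.
- rewrite (_ : (fun t => _) = fun t => complex.Re (f t))//.
  by apply/funext => t; case: (f t).
- rewrite (_ : (fun t => _) = \- (fun t => complex.Im (f t))).
    exact: measurable_funN.
  by apply/funext => t /=; case: (f t).
- by exists M => t; rewrite norm_conjC.
Qed.

Lemma bounded_mfun_sum (J : Type) (r : seq J) (p : pred J) (F : J -> T -> C) :
  (forall j, bounded_mfun (F j)) ->
  bounded_mfun (fun t => \sum_(j <- r | p j) F j t).
Proof.
move=> hF; rewrite (_ : (fun t => _) = \sum_(j <- r | p j) F j); last first.
  by apply/funext => t; rewrite fct_sumE.
by elim/big_ind: _ => //; [exact: (bounded_mfun_cst 0)|exact: bounded_mfunD].
Qed.

Lemma bounded_mfun_integrable f : bounded_mfun f ->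
  P.-integrable setT (EFin \o (fun t => complex.Re (f t))) /\
  P.-integrable setT (EFin \o (fun t => complex.Im (f t))).
Proof.
move=> [rf jf [M hM]].
have fin : (P setT < +oo)%E by rewrite probability_setT ltry.
(* The order on [C] compares real parts at equal imaginary parts, so [M] supplies the real bound
   [complex.Re M]. *)
split; apply: (measurable_bounded_integrable _ fin) => //;
  exists (complex.Re M); split; rewrite ?num_real// => r /ltW hr t _ /=;
  apply: le_trans hr.
- by have := le_trans (normc_ge_Re (f t)) (hM t); rewrite lecE => /andP[].
(* A quarter turn makes the imaginary part of [f t] a real part, up to sign, without changing the
   modulus. *)
- have := normc_ge_Re (f t * 'i%C); rewrite ReiNIm normrN normrM.
  rewrite (_ : `|'i%C| = 1) ?mulr1; last by rewrite complexiE normCi.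
  by move=> /le_trans /(_ (hM t)); rewrite lecE => /andP[].
Qed.

Lemma ExE f : Ex P f = Complex (\int[P]_t complex.Re (f t))
                               (\int[P]_t complex.Im (f t)).
Proof. by rewrite [RHS]complexE complexiE. Qed.

Lemma Ex_cst c : Ex P (fun=> c) = c.
Proof.
have PT : fine (P setT) = 1 by rewrite probability_setT.
by case: c => a b; rewrite ExE /= !Rintegral_cst// [fine _]PT !mulr1.
Qed.

Lemma ExD f g : bounded_mfun f -> bounded_mfun g ->
  Ex P (fun t => f t + g t) = Ex P f + Ex P g.
Proof.
move=> /bounded_mfun_integrable[rf jf] /bounded_mfun_integrable[rg jg].
rewrite !ExE; under eq_Rintegral do rewrite ReD.
by under [X in Complex _ X]eq_Rintegral do rewrite ImD; rewrite !RintegralD.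
Qed.

Lemma ExZ c f : bounded_mfun f -> Ex P (fun t => c * f t) = c * Ex P f.
Proof.
move=> /bounded_mfun_integrable[rf jf].
have zl (a : R) h : P.-integrable setT (EFin \o h) ->
    P.-integrable setT (EFin \o (fun t => a * h t)).
  by move=> ih; have := integrableZl measurableT a ih.
rewrite !ExE; under eq_Rintegral do rewrite ReM.
under [X in Complex _ X]eq_Rintegral do rewrite ImM.
rewrite RintegralB ?RintegralD ?RintegralZl//; try exact: zl.
by case: c => a b.
Qed.

Lemma Ex_sum (J : Type) (r : seq J) (p : pred J) (F : J -> T -> C) :
  (forall j, bounded_mfun (F j)) ->
  Ex P (fun t => \sum_(j <- r | p j) F j t) = \sum_(j <- r | p j) Ex P (F j).
Proof.
move=> hF; elim: r => [|j r ih].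
  by under [in LHS]eq_fun do rewrite big_nil; rewrite Ex_cst big_nil.
under [in LHS]eq_fun do rewrite big_cons.
rewrite big_cons -ih; case: (p j) => //.
by rewrite ExD//; exact: bounded_mfun_sum.
Qed.

End Expectation.

(** * Interchange of two expectations for separable functions *)

Section Exchange.
Context (R : realType).
Context (dT : measure_display) (T : measurableType dT) (P : probability T R).
Context (dS : measure_display) (S : measurableType dS) (Q : probability S R).
Local Notation C := (R[i]).

(* Polynomials in the entries of [U t] and [W x] are finite sums of products of
   a function of [t] and one of [x]: iterated expectations then commute by
   linearity alone. *)
Inductive separable : (T -> S -> C) -> Prop :=
| separable_prod f g of bounded_mfun f & bounded_mfun g :
    separable (fun t x => f t * g x)
| separableD F G of separable F & separable G :
    separable (fun t x => F t x + G t x).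

Lemma separable_l f : bounded_mfun f -> separable (fun t _ => f t).
Proof.
move=> hf; rewrite (_ : (fun _ => _) = fun t x => f t * 1); last first.
  by apply/funext => t; apply/funext => x; rewrite mulr1.
by apply: separable_prod => //; exact: bounded_mfun_cst.
Qed.

Lemma separable_r g : bounded_mfun g -> separable (fun _ => g).
Proof.
move=> hg; rewrite (_ : (fun _ => _) = fun t x => 1 * g x); last first.
  by apply/funext => t; apply/funext => x; rewrite mul1r.
by apply: separable_prod => //; exact: bounded_mfun_cst.
Qed.

Lemma separableM F G :
  separable F -> separable G -> separable (fun t x => F t x * G t x).
Proof.
move=> sF sG; elim: sF => [f g hf hg|F1 F2 _ ih1 _ ih2]; last first.
  under eq_fun => t do under eq_fun => x do rewrite mulrDl.
  exact: separableD.
elim: sG => [f' g' hf' hg'|G1 G2 _ ih1 _ ih2]; last first.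
  under eq_fun => t do under eq_fun => x do rewrite mulrDr.
  exact: separableD.
under eq_fun => t do under eq_fun => x do rewrite mulrACA.
by apply: separable_prod; exact: bounded_mfunM.
Qed.

Lemma separable_sum (J : Type) (r : seq J) (F : J -> T -> S -> C) :
  (forall j, separable (F j)) ->
  separable (fun t x => \sum_(j <- r) F j t x).
Proof.
move=> hF; elim: r => [|j r ih].
  under eq_fun => t do under eq_fun => x do rewrite big_nil.
  by apply: separable_l; exact: bounded_mfun_cst.
under eq_fun => t do under eq_fun => x do rewrite big_cons.
exact: separableD.
Qed.

(** The interchange for a sum uses linearity of both the inner and the outer expectation, so the
    induction must carry boundedness of the sections and of the partial expectations. *)
Lemma separable_Ex F : separable F ->
  [/\ forall t, bounded_mfun (F t), forall x, bounded_mfun (F^~ x),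
      bounded_mfun (fun x => Ex P (F^~ x)),
      bounded_mfun (fun t => Ex Q (F t)) &
      Ex Q (fun x => Ex P (F^~ x)) = Ex P (fun t => Ex Q (F t))].
Proof.
have Mc c dX (X : measurableType dX) (f : X -> C) :
    bounded_mfun f -> bounded_mfun (fun t => f t * c).
  by move=> hf; apply: bounded_mfunM => //; exact: bounded_mfun_cst.
elim=> {F} [f g hf hg|F G _ [F1 F2 F3 F4 F5] _ [G1 G2 G3 G4 G5]].
- have eP x : Ex P (fun t => f t * g x) = Ex P f * g x.
    by under eq_fun do rewrite mulrC; rewrite ExZ// mulrC.
  have eQ t : Ex Q (fun x => f t * g x) = f t * Ex Q g by rewrite ExZ.
  split=> [t|x|||]; [exact: bounded_mfunZ|exact: Mc| | |].
  + by under eq_fun do rewrite eP; exact: bounded_mfunZ.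
  + by under eq_fun do rewrite eQ; exact: Mc.
  + under eq_fun do rewrite eP; under [in RHS]eq_fun do rewrite eQ.
    rewrite ExZ//; under [in RHS]eq_fun do rewrite mulrC.
    by rewrite ExZ// mulrC.
- have eP x : Ex P (fun t => F t x + G t x) = Ex P (F^~ x) + Ex P (G^~ x).
    exact: ExD.
  have eQ t : Ex Q (fun x => F t x + G t x) = Ex Q (F t) + Ex Q (G t).
    exact: ExD.
  split=> [t|x|||]; [exact: bounded_mfunD|exact: bounded_mfunD| | |].
  + by under eq_fun do rewrite eP; exact: bounded_mfunD.
  + by under eq_fun do rewrite eQ; exact: bounded_mfunD.
  + under eq_fun do rewrite eP; under [in RHS]eq_fun do rewrite eQ.
    by rewrite ExD// ExD// F5 G5.
Qed.

End Exchange.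

(** * Adjoints, conjugation [X A X'] and entries of unitaries *)

Section Adjoint.
Context (R : realType).
Local Notation C := (R[i]).

Lemma adjE m k (A : 'M[C]_(m, k)) i j : adj A i j = Num.conj (A j i).
Proof. by rewrite !mxE. Qed.

Lemma adjM m k p (A : 'M[C]_(m, k)) (B : 'M[C]_(k, p)) :
  adj (A *m B) = adj B *m adj A.
Proof. by rewrite /adj trmx_mul map_mxM. Qed.

Lemma adj_affine m (u v : C) (A : 'M[C]_m) :
  adj (u%:M + v *: A) = (Num.conj u)%:M + Num.conj v *: adj A.
Proof.
by apply/matrixP => i j; rewrite !mxE rmorphD rmorphM rmorphMn /= eq_sym.
Qed.

(** Prepares conjugation by the square root of a transposition in [moment2_diag], which has this
    affine form. *)
Lemma affine_tperml m (u v : C) (a b : 'I_m) (X : 'M[C]_m) i j :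
  ((u%:M + v *: tperm_mx a b) *m X) i j = u * X i j + v * X (tperm a b i) j.
Proof. by rewrite mulmxDl mul_scalar_mx -scalemxAl -xrowE !mxE. Qed.

Lemma affine_tpermr m (u v : C) (a b : 'I_m) (X : 'M[C]_m) i j :
  (X *m (u%:M + v *: tperm_mx a b)) i j = u * X i j + v * X i (tperm a b j).
Proof. by rewrite mulmxDr mul_mx_scalar -scalemxAr -xcolE !mxE. Qed.

Lemma unitaryV m (U : 'M[C]_m) : unitary U -> adj U *m U = 1%:M.
Proof. exact: mulmx1C. Qed.

Lemma mxtrace_sandwich m (U A : 'M[C]_m) :
  unitary U -> \tr (U *m A *m adj U) = \tr A.
Proof. by move=> /unitaryV hU; rewrite mxtrace_mulC mulmxA hU mul1mx. Qed.

Lemma sandwichE m (X A : 'M[C]_m) i j : (X *m A *m adj X) i j =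
  \sum_(p : 'I_m * 'I_m) A p.1 p.2 * (X i p.1 * Num.conj (X j p.2)).
Proof.
rewrite mxE -(pair_bigA _ (fun a b => A a b * (X i a * Num.conj (X j b))))/=.
rewrite exchange_big /=; apply: eq_bigr => b _; rewrite adjE mxE mulr_suml.
by apply: eq_bigr => a _; rewrite mulrAC mulrC mulrA.
Qed.

(** The squared modulus is one term of the nonnegative sum that makes up the diagonal entry 1 of
    [U *m adj U]. *)
Lemma unitary_entry_le1 m (U : 'M[C]_m) i j : unitary U -> `|U i j| <= 1.
Proof.
move=> /(congr1 (fun M : 'M[C]_m => M i i)); rewrite !mxE eqxx => h.
rewrite -(expr_le1 (n := 2))// normCK -[leRHS]h (bigD1 j)//= adjE lerDl.
by apply: sumr_ge0 => k _; rewrite adjE mul_conjC_ge0.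
Qed.

Lemma random_unitary_entry m dT (T : measurableType dT) (U : T -> 'M[C]_m) i j :
  random_unitary U -> bounded_mfun (fun t => U t i j).
Proof.
move=> [uU mU]; have [mre mim] := mU i j; split=> //.
by exists 1 => t; exact: unitary_entry_le1.
Qed.

Lemma bounded_mfun_sandwich m dT (T : measurableType dT) (X : T -> 'M[C]_m) A :
  (forall i j, bounded_mfun (fun t => X t i j)) ->
  forall i j, bounded_mfun (fun t => (X t *m A *m adj (X t)) i j).
Proof.
move=> hX i j; under eq_fun do rewrite sandwichE.
apply: bounded_mfun_sum => p; apply: bounded_mfunZ.
by apply: bounded_mfunM => //; exact: bounded_mfun_conj.
Qed.

(** The bridge to the moment hypotheses: two conjugated entries involve only monomials of degree
    (2,2) in [X], so both Haar invariance and the design property can be applied term by term. *)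
Lemma Ex_sandwich2 m dT (T : measurableType dT) (P : probability T R)
    (X : T -> 'M[C]_m) (A B : 'M[C]_m) i j k l :
  (forall i j, bounded_mfun (fun t => X t i j)) ->
  Ex P (fun t => (X t *m A *m adj (X t)) i j * (X t *m B *m adj (X t)) k l) =
  \sum_(p : 'I_m * 'I_m) \sum_(q : 'I_m * 'I_m) A p.1 p.2 * B q.1 q.2 *
    Ex P (fun t => monomial (X t) [:: (i, p.1); (k, q.1)]
                                  [:: (j, p.2); (l, q.2)]).
Proof.
move=> hX; have hm p q : bounded_mfun (fun t =>
    monomial (X t) [:: (i, p.1); (k, q.1)] [:: (j, p.2); (l, q.2)]).
  rewrite /monomial; under eq_fun do rewrite !big_cons !big_nil !mulr1/=.
  apply: bounded_mfunM; apply: bounded_mfunM => //; exact: bounded_mfun_conj.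
have hcm c p q : bounded_mfun (fun t => c *
    monomial (X t) [:: (i, p.1); (k, q.1)] [:: (j, p.2); (l, q.2)]).
  exact: bounded_mfunZ.
transitivity (Ex P (fun t =>
  \sum_(p : 'I_m * 'I_m) \sum_(q : 'I_m * 'I_m) A p.1 p.2 * B q.1 q.2 *
    monomial (X t) [:: (i, p.1); (k, q.1)] [:: (j, p.2); (l, q.2)])).
  congr Ex; apply/funext => t; rewrite !sandwichE big_distrlr /=.
  apply: eq_bigr => p _; apply: eq_bigr => q _.
  by rewrite /monomial !big_cons !big_nil/=; ring.
rewrite Ex_sum => [|p]; last by apply: bounded_mfun_sum => q.
apply: eq_bigr => p _; rewrite Ex_sum//.
by apply: eq_bigr => q _; rewrite ExZ.
Qed.

End Adjoint.

(** * Second moments of a Haar unitary *)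

Section HaarMoments.
Context (R : realType) (m : nat).
Context (dS : measure_display) (S : measurableType dS) (Q : probability S R).
Local Notation C := (R[i]).
Context (W : S -> 'M[C]_m) (hW : haar Q W).
Context (A B : 'M[C]_m).

Let Y x := W x *m A *m adj (W x).
Let Z x := W x *m B *m adj (W x).

Definition moment2 i j k l := Ex Q (fun x => Y x i j * Z x k l).
Local Notation t := moment2.

Let Y_bounded i j : bounded_mfun (fun x => Y x i j).
Proof.
by apply: bounded_mfun_sandwich => k l; case: hW => /random_unitary_entry.
Qed.

Let Z_bounded i j : bounded_mfun (fun x => Z x i j).
Proof.
by apply: bounded_mfun_sandwich => k l; case: hW => /random_unitary_entry.
Qed.

(** Conjugating by [V] amounts to replacing [W] by [V W], which has the same mixed moments. *)
Lemma moment2_invariant V i j k l : unitary V ->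
  Ex Q (fun x => (V *m Y x *m adj V) i j * (V *m Z x *m adj V) k l) = t i j k l.
Proof.
move=> uV; have Wb a b : bounded_mfun (fun x => W x a b).
  by case: hW => /random_unitary_entry.
have VWb a b : bounded_mfun (fun x => (V *m W x) a b).
  under eq_fun do rewrite mxE; apply: bounded_mfun_sum => c.
  exact: bounded_mfunZ.
have -> : (fun x => (V *m Y x *m adj V) i j * (V *m Z x *m adj V) k l) =
  (fun x => ((V *m W x) *m A *m adj (V *m W x)) i j *
            ((V *m W x) *m B *m adj (V *m W x)) k l).
  by apply/funext => x; rewrite /Y /Z adjM !mulmxA.
rewrite /t !Ex_sandwich2//; case: hW => _ inv.
by do 2![apply: eq_bigr => ? _]; rewrite inv.
Qed.

(** A linear form in the matrix entries is encoded as a list of coefficients with positions; this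
    serves the four-term forms of [moment2_diag] and the traces of [haar_trace2]. *)
Lemma Ex_bilinear (r r' : seq (C * ('I_m * 'I_m))) :
  Ex Q (fun x => (\sum_(p <- r) p.1 * Y x p.2.1 p.2.2) *
                 (\sum_(q <- r') q.1 * Z x q.2.1 q.2.2)) =
  \sum_(p <- r) \sum_(q <- r') p.1 * q.1 * t p.2.1 p.2.2 q.2.1 q.2.2.
Proof.
have YZb i j k l : bounded_mfun (fun x => Y x i j * Z x k l).
  exact: bounded_mfunM.
have cYZb c i j k l : bounded_mfun (fun x => c * (Y x i j * Z x k l)).
  exact: bounded_mfunZ.
under eq_fun => x.
  rewrite big_distrlr /=.
  under eq_bigr => p _ do under eq_bigr => q _ do rewrite mulrACA.
  over.
rewrite Ex_sum => [|p]; last exact: bounded_mfun_sum.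
apply: eq_bigr => p _; rewrite Ex_sum => [|q//].
by apply: eq_bigr => q _; rewrite ExZ.
Qed.

Lemma moment2_perm (s : 'S_m) i j k l : t (s i) (s j) (s k) (s l) = t i j k l.
Proof.
have adjs : adj (perm_mx s) = perm_mx s^-1 :> 'M[C]_m.
  by rewrite /adj tr_perm_mx map_perm_mx.
have us : unitary (perm_mx s : 'M[C]_m).
  by rewrite /unitary adjs -perm_mxM mulgV perm_mx1.
rewrite -(moment2_invariant i j k l us) adjs /t; congr Ex; apply/funext => x.
by rewrite -!row_permE -!col_permE !mxE.
Qed.

(** Conjugation by the diagonal unitary [D] with phase 'i at [a] scales entry (i, j) by [u i] times
    the conjugate of [u j]. A sign would not suffice: if [i = k] the phase enters squared, and
    (-1)^2 = 1 gives no information. *)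
Lemma moment2_phase a i j k l
    (u := fun b : 'I_m => (if b == a then 'i else 1) : C) :
  u i * Num.conj (u j) * (u k * Num.conj (u l)) * t i j k l = t i j k l.
Proof.
have un b : u b * Num.conj (u b) = 1.
  by rewrite /u; case: eqP => _; rewrite ?conjC1 ?mulr1// -normCK normCi expr1n.
pose D : 'M[C]_m := diag_mx (\row_b u b).
have adjD : adj D = diag_mx (\row_b Num.conj (u b)).
  rewrite /adj tr_diag_mx map_diag_mx; congr diag_mx.
  by apply/rowP => b; rewrite !mxE.
have uD : unitary D.
  apply/matrixP => b c; rewrite adjD mul_diag_mx !mxE.
  by case: eqP => [->|_]; rewrite ?mulr1n ?mulr0n ?un ?mulr0.
rewrite -[RHS](moment2_invariant i j k l uD) adjD -ExZ;
  last exact: bounded_mfunM.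
congr Ex; apply/funext => x; rewrite !mul_mx_diag !mul_diag_mx !mxE; ring.
Qed.

Lemma moment2_eq0 i j k l :
  ~~ ((i == j) && (k == l)) -> ~~ ((i == l) && (j == k)) -> t i j k l = 0.
Proof.
have ii : 'i * 'i = -1 :> C by rewrite -expr2 sqrCi.
have i1 : 'i != 1 :> C.
  apply/eqP => h; move: ii; rewrite h mulr1 => /eqP.
  by rewrite -subr_eq0 opprK -mulr2n pnatr_eq0.
have z (c z : C) : c != 1 -> c * z = z -> z = 0.
  move=> c1 /eqP; rewrite -subr_eq0 -{2}[z]mul1r -mulrBl mulf_eq0.
  by rewrite subr_eq0 (negPf c1) => /eqP.
have N1 : -1 != 1 :> C.
  by rewrite eq_sym -subr_eq0 opprK -mulr2n pnatr_eq0.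
have [<-{j}|ij] := eqVneq i j => /=.
  (* The factors at [i] cancel, and [k != l] leaves the multiplier 'i. *)
  move=> kl _; apply: z _ (moment2_phase k i i k l).
  rewrite eqxx [l == k]eq_sym (negPf kl) conjC1 mulr1.
  by case: ifP; rewrite ?conjC1 ?mul1r// -normCK normCi expr1n mul1r.
move=> _; have [<-{l}|il] := eqVneq i l => /=.
  move=> jk; apply: z _ (moment2_phase k i j k i).
  rewrite eqxx (negPf jk) conjC1 mulr1.
  by case: ifP; rewrite ?conjC1 ?mul1r ?mulr1// mulrA ii conjCi mulrNN mul1r.
(* Now [i] differs from both conjugated indices [j] and [l]: the multiplier is 'i, or -1 when
   [k = i]. *)
move=> _; apply: z _ (moment2_phase i i j k l).
rewrite eqxx [j == i]eq_sym [l == i]eq_sym (negPf ij) (negPf il) conjC1 !mulr1.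
by case: ifP; rewrite ?ii ?mulr1.
Qed.

(** Under the square root [V] of the transposition, entry (a, a) becomes half the sum of the entries
    (a, a) and (b, b), plus 'i/2 times the difference of the entries (a, b) and (b, a). Invariance
    of [t a a a a] then yields a linear relation. *)
Lemma moment2_diag a b : a != b -> t a a a a = t a a b b + t a b b a.
Proof.
move=> ab; set T : 'M[C]_m := tperm_mx a b.
have adjT : adj T = T by rewrite /adj tr_tperm_mx map_perm_mx.
have TT : T *m T = 1%:M by rewrite -perm_mxM tperm2 perm_mx1.
(* [u%:M + v *: T] is a unitary square root of [T]. *)
pose u : C := (1 + 'i) / 2; pose v : C := (1 - 'i) / 2.
have ii : 'i * 'i = -1 :> C by rewrite -expr2 sqrCi.
have uJ : Num.conj u = v.
  by rewrite /u /v rmorphM rmorphD rmorph1 /= conjCi fmorphV rmorph_nat.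
have vJ : Num.conj v = u by rewrite -uJ conjCK.
have uv : u * v = 2^-1.
  rewrite (_ : u * v = (1 - 'i * 'i) / 4); first by rewrite ii; field.
  by rewrite /u /v; field.
have uu : u * u = 'i / 2.
  rewrite (_ : u * u = (1 + 2 * 'i + 'i * 'i) / 4); first by rewrite ii; field.
  by rewrite /u; field.
have vv : v * v = - ('i / 2).
  rewrite (_ : v * v = (1 - 2 * 'i + 'i * 'i) / 4); first by rewrite ii; field.
  by rewrite /v; field.
pose V : 'M[C]_m := u%:M + v *: T.
have adjV : adj V = v%:M + u *: T.
  by rewrite adj_affine adjT uJ vJ.
have VE (X : 'M[C]_m) : (V *m X *m adj V) a a =
    2^-1 * X a a + (2^-1 * X b b + ('i / 2 * X a b + - ('i / 2) * X b a)).
  rewrite adjV affine_tpermr !affine_tperml !tpermL.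
  by rewrite -vv -uu -uv; ring.
have uV : unitary V.
  rewrite /unitary adjV mulmxDl mul_scalar_mx -scalemxAl mulmxDr mul_mx_scalar.
  rewrite -scalemxAr TT !scalerDr !scalerA scale_scalar_mx uu vv [v * u]mulrC uv.
  rewrite scaleNr addrA addrK mulr1 scale_scalar_mx uv -raddfD /=.
  by congr scalar_mx; field.
pose r : seq (C * ('I_m * 'I_m)) := [:: (2^-1, (a, a)); (2^-1, (b, b));
  ('i / 2, (a, b)); (- ('i / 2), (b, a))].
have VEr (X : 'M[C]_m) : (V *m X *m adj V) a a =
    \sum_(p <- r) p.1 * X p.2.1 p.2.2.
  by rewrite VE /r !big_cons big_nil addr0.
have sw i j k l : t (tperm a b i) (tperm a b j) (tperm a b k) (tperm a b l) =
    t i j k l by exact: moment2_perm.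
have z := moment2_eq0; have ba : b != a by rewrite eq_sym.
have := moment2_invariant a a a a uV.
under eq_fun do rewrite !VEr.
rewrite Ex_bilinear /r !big_cons !big_nil /= !addr0.
(* Of the sixteen products ten vanish; swapping [a] and [b] identifies the remaining six in
   pairs. *)
rewrite (z a a a b) ?(z a a b a) ?(z b b a b) ?(z b b b a) ?(z a b a a)
  ?(z a b b b) ?(z a b a b) ?(z b a a a) ?(z b a b b) ?(z b a b a)
  ?eqxx ?(negPf ab) ?(negPf ba)//.
have -> : t b b b b = t a a a a by rewrite -(sw a a a a) tpermL.
have -> : t b b a a = t a a b b by rewrite -(sw a a b b) tpermL tpermR.
have -> : t b a a b = t a b b a by rewrite -(sw a b b a) tpermL tpermR.
move=> h; have {}h : t a a a a =
    2^-1 * (t a a a a + t a a b b) + 2^-1 * t a b b a.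
  rewrite -[LHS]h; transitivity (2^-1 * (t a a a a + t a a b b)
    - 2^-1 * ('i * 'i) * t a b b a); first by field.
  by rewrite ii; field.
by transitivity (2 * t a a a a - t a a a a); [ring|rewrite {1}h; field].
Qed.

(** Double transitivity: the first transposition sends [a] to [i], the second sends the image of [b]
    to [k] and fixes [i], which differs from both. *)
Lemma perm_pair (a b i k : 'I_m) : a != b -> i != k ->
  exists s : 'S_m, s a = i /\ s b = k.
Proof.
move=> ab ik; exists (tperm a i * tperm (tperm a i b) k)%g.
rewrite !permM tpermL; split; last by rewrite tpermL.
apply: tpermD; last by rewrite eq_sym.
apply: contra_neq ab => h.
by apply: (@perm_inj _ (tperm a i)); rewrite h tpermL.
Qed.

Lemma moment2_deltas : (1 < m)%N -> exists al be, forall i j k l,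
  t i j k l = al *+ ((i == j) && (k == l)) + be *+ ((i == l) && (j == k)).
Proof.
move=> m1; pose a : 'I_m := Ordinal (ltnW m1); pose b : 'I_m := Ordinal m1.
have ab : a != b by [].
have tl i k : i != k -> t i i k k = t a a b b /\ t i k k i = t a b b a.
  by move=> ik; have [s [<- <-]] := perm_pair ab ik; rewrite !moment2_perm.
exists (t a a b b), (t a b b a) => i j k l.
have [/andP[/eqP<- /eqP<-]|n1] := boolP ((i == j) && (k == l)).
  rewrite mulr1n andbb; case: (eqVneq i k) => [<-{k l}|/tl[]//]; last first.
    by rewrite addr0.
  (* With all four indices equal, [moment2_diag] needs some other index, available because
     [1 < m]. *)
  have [c ic] : exists c, i != c.
    by case: (eqVneq i a) => [->|ia]; [exists b|exists a].
  by rewrite (moment2_diag ic); have [-> ->] := tl _ _ ic.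
have [/andP[/eqP il /eqP jk]|n2] := boolP ((i == l) && (j == k)).
  subst k l.
  rewrite add0r; have [] // := tl i j.
  by move: n1; rewrite [j == i]eq_sym !andbb.
by rewrite moment2_eq0// addr0.
Qed.

Lemma sum_delta (V : nmodType) (I : finType) (i : I) (F : I -> V) :
  \sum_j F j *+ (i == j) = F i.
Proof.
rewrite (bigD1 i)//= eqxx mulr1n big1 ?addr0// => j.
by rewrite eq_sym => /negPf->.
Qed.

(** With [moment2_swap], the degree-two Weingarten coefficients of the identity and the swap: the
    solution of the two trace equations [h1] and [h2] in [moment2E]. *)
Definition moment2_id : C :=
  (m%:R * (\tr A * \tr B) - \tr (A *m B)) / (m%:R * (m%:R ^+ 2 - 1)).

Definition moment2_swap : C :=
  (m%:R * \tr (A *m B) - \tr A * \tr B) / (m%:R * (m%:R ^+ 2 - 1)).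

Lemma moment2E : (1 < m)%N -> forall i j k l, t i j k l =
  moment2_id *+ ((i == j) && (k == l)) + moment2_swap *+ ((i == l) && (j == k)).
Proof.
move=> m1; have [al [be tE]] := moment2_deltas m1.
have uW x : unitary (W x) by case: hW => -[].
have YZb i j k l : bounded_mfun (fun x => Y x i j * Z x k l).
  exact: bounded_mfunM.
(* Contracting i = j and k = l produces the product of the traces, which conjugation by [W] leaves
   constant. *)
have h1 : \tr A * \tr B = m%:R ^+ 2 * al + m%:R * be.
  transitivity (\sum_i \sum_k t i i k k).
    rewrite -[LHS](Ex_cst Q); under [RHS]eq_bigr do rewrite -Ex_sum//.
    rewrite -Ex_sum => [|i]; last exact: bounded_mfun_sum.
    congr Ex; apply/funext => x; rewrite -big_distrlr /=.
    by rewrite -(mxtrace_sandwich A (uW x)) -(mxtrace_sandwich B (uW x)).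
  under eq_bigr do under eq_bigr do rewrite tE !eqxx !andbb.
  under eq_bigr do rewrite big_split /= sum_delta sumr_const card_ord.
  rewrite big_split /= !sumr_const !card_ord -mulr_natl -mulr_natl.
  by rewrite -(mulr_natl be) -mulr_natl; ring.
(* Contracting j = k and i = l produces the trace of the product, constant for the same reason. *)
have h2 : \tr (A *m B) = m%:R * al + m%:R ^+ 2 * be.
  transitivity (\sum_i \sum_j t i j j i).
    rewrite -[LHS](Ex_cst Q); under [RHS]eq_bigr do rewrite -Ex_sum//.
    rewrite -Ex_sum => [|i]; last exact: bounded_mfun_sum.
    congr Ex; apply/funext => x; rewrite -(mxtrace_sandwich _ (uW x)).
    rewrite (_ : _ *m _ *m _ = Y x *m Z x).
      by apply: eq_bigr => i _; rewrite mxE.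
    by rewrite /Y /Z !mulmxA -[_ *m adj (W x) *m W x]mulmxA unitaryV// mulmx1.
  under eq_bigr => i _ do
    under eq_bigr => j _ do rewrite tE !eqxx [j == i]eq_sym !andbb.
  under eq_bigr do rewrite big_split /= sum_delta sumr_const card_ord.
  rewrite big_split /= !sumr_const !card_ord -mulr_natl.
  by rewrite -!(mulr_natl be) -mulr_natl; ring.
have m0 : m%:R != 0 :> C by rewrite pnatr_eq0 -lt0n ltnW.
have m21 : m%:R ^+ 2 - 1 != 0 :> C.
  by rewrite -natrX subr_eq0 pnatr_eq1 -(exp1n 2) eqn_exp2r// gtn_eqF.
have -> : moment2_id = al by rewrite /moment2_id h1 h2; field; rewrite m21.
have -> : moment2_swap = be by rewrite /moment2_swap h1 h2; field; rewrite m21.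
exact: tE.
Qed.

Lemma haar_trace2 (D E : 'M[C]_m) : (1 < m)%N ->
  Ex Q (fun x => \tr (Y x *m D) * \tr (Z x *m E)) =
  moment2_id * (\tr D * \tr E) + moment2_swap * \tr (D *m E).
Proof.
(* The transposed entries of [X] are the coefficients of the linear form [M] to [\tr (M *m X)]. *)
move=> m1; pose r (X : 'M[C]_m) := [seq (X p.2 p.1, p) | p : 'I_m * 'I_m].
have rE (M X : 'M[C]_m) : \tr (M *m X) = \sum_(p <- r X) p.1 * M p.2.1 p.2.2.
  rewrite big_map big_enum /= -(pair_bigA _ (fun i j => X j i * M i j))/=.
  by apply: eq_bigr => i _; rewrite mxE; apply: eq_bigr => j _; rewrite mulrC.
under eq_fun do rewrite !rE.
rewrite Ex_bilinear big_map big_enum /=.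
under eq_bigr do rewrite big_map big_enum /=.
rewrite -(pair_bigA _ (fun i j => \sum_q D j i * E q.2 q.1 * t i j q.1 q.2))/=.
rewrite [\tr (D *m E)]mxtrace_mulC.
rewrite [\tr D * _]big_distrlr !mulr_sumr -big_split; apply: eq_bigr => i _ /=.
rewrite mxE !mulr_sumr.
(* Each product of two deltas is split into nested ones so that [sum_delta] removes one index at a
   time. *)
have expand j k l : D j i * E l k * t i j k l =
    (moment2_id * (D j i * E l k)) *+ (k == l) *+ (i == j) +
    (moment2_swap * (D j i * E l k)) *+ (i == l) *+ (j == k).
  rewrite moment2E// -!mulrnA !mulnb [(k == l) && _]andbC mulrDr !mulrnAr.
  by congr (_ *+ _ + _ *+ _); rewrite mulrC.
transitivity (\sum_j ((\sum_k moment2_id * (D j i * E k k)) *+ (i == j) +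
    moment2_swap * (D j i * E i j))).
  apply: eq_bigr => j _.
  rewrite -(pair_bigA _ (fun k l => D j i * E l k * t i j k l))/=.
  under eq_bigr do under eq_bigr do rewrite expand.
  under eq_bigr do rewrite big_split /= !sumrMnl !sum_delta.
  by rewrite big_split /= sumrMnl sum_delta.
rewrite big_split /= sum_delta; congr (_ + _).
by apply: eq_bigr => j _; rewrite [E i j * _]mulrC.
Qed.

End HaarMoments.

(** * The measurement channel and Haar averages of the estimator moments *)

Section Shadows.
Context (R : realType) (m : nat).
Context (dT : measure_display) (T : measurableType dT) (P : probability T R).
Context (dS : measure_display) (S : measurableType dS) (Q : probability S R).
Local Notation C := (R[i]).
Context (U : T -> 'M[C]_m) (W : S -> 'M[C]_m).
Context (hW : haar Q W) (hU : two_design P U Q W) (m1 : (1 < m)%N).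

Let unitaryU t : unitary (U t). Proof. by case: hU => -[]. Qed.
Let unitaryW x : unitary (W x). Proof. by case: hW => -[]. Qed.

Let U_bounded i j : bounded_mfun (fun t => U t i j).
Proof. by case: hU => /random_unitary_entry. Qed.

Let UAU_bounded A i j : bounded_mfun (fun t => (U t *m A *m adj (U t)) i j).
Proof. exact: bounded_mfun_sandwich. Qed.

Let WAW_bounded A i j : bounded_mfun (fun x => (W x *m A *m adj (W x)) i j).
Proof.
by apply: bounded_mfun_sandwich => k l; case: hW => /random_unitary_entry.
Qed.

Let dimE : m%:R != 0 :> C /\ m%:R ^+ 2 - 1 != 0 :> C /\ m%:R + 1 != 0 :> C.
Proof.
rewrite pnatr_eq0 -lt0n ltnW// -natrX subr_eq0 pnatr_eq1 -(exp1n 2) eqn_exp2r//.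
by rewrite gtn_eqF// -(natrD _ m 1) pnatr_eq0 addn1.
Qed.

Lemma design_moment2 A B i j k l :
  Ex P (fun t => (U t *m A *m adj (U t)) i j * (U t *m B *m adj (U t)) k l) =
  moment2 Q W A B i j k l.
Proof.
rewrite Ex_sandwich2// /moment2 Ex_sandwich2 => [|a b]; last first.
  by case: hW => /random_unitary_entry.
by case: hU => _ h; do 2![apply: eq_bigr => ? _]; rewrite h.
Qed.

Lemma sandwich_delta (X : 'M[C]_m) a b i j :
  (X *m delta_mx a b *m adj X) i j = X i a * Num.conj (X j b).
Proof.
rewrite sandwichE (bigD1 (a, b))//= big1 ?addr0 => [|[k l]].
  by rewrite mxE !eqxx mul1r.
by rewrite xpair_eqE mxE => /negPf->; rewrite mul0r.
Qed.

(** Entry (k, l) of the projector rotated back by [U] is the diagonal entry (b, b) of the matrix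
    unit [delta_mx l k] conjugated by [U]. The channel is thus a sum over [b] of second moments with
    all indices equal to [b]. *)
Lemma meas_channelE X :
  meas_channel P U X = (m%:R + 1)^-1 *: (X + (\tr X)%:M).
Proof.
have [m0 [m21 mS]] := dimE.
apply/matrixP => k l; rewrite !mxE.
transitivity (Ex P (fun t => \sum_b (U t *m X *m adj (U t)) b b *
    (U t *m delta_mx l k *m adj (U t)) b b)).
  congr Ex; apply/funext => t; apply: eq_bigr => b _; congr (_ * _).
  have {2}<- : adj (adj (U t)) = U t.
    by apply/matrixP => i j; rewrite !adjE conjCK.
  by rewrite !sandwich_delta !adjE conjCK mulrC.
rewrite Ex_sum => [|b]; last exact: bounded_mfunM.
under eq_bigr do rewrite design_moment2 (moment2E hW)// !eqxx !mulr1n.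
rewrite sumr_const card_ord -mulr_natl /moment2_id /moment2_swap.
have -> : \tr (X *m delta_mx l k) = X k l.
  rewrite /mxtrace (bigD1 k)//= big1 ?addr0 => [|i ik].
    by rewrite mxE (bigD1 l)//= big1 ?addr0 => [|j jl];
      rewrite mxE ?eqxx ?mulr1// (negPf jl) mulr0.
  by rewrite mxE big1// => j _; rewrite mxE [i == k](negPf ik) andbF mulr0.
have -> : \tr (delta_mx l k) = (k == l)%:R :> C.
  rewrite /mxtrace (bigD1 l)//= mxE eqxx /= big1 ?addr0 1?eq_sym// => i il.
  by rewrite mxE (negPf il).
rewrite mulr_natr; field.
by rewrite m0 mS /= m21.
Qed.

(** For a state this is the probability of outcome [b]; for a traceless observable it is the
    single-shot estimate divided by [m + 1]. [wprob] is the same after rotation by [W]. *)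
Let prob A t b := (U t *m A *m adj (U t)) b b.
Let wprob A t x b := (U t *m (W x *m A *m adj (W x)) *m adj (U t)) b b.

Let sum_prob A t : \sum_b prob A t b = \tr A.
Proof. exact: mxtrace_sandwich. Qed.

Let separable_prob A b : separable (fun t (_ : S) => prob A t b).
Proof. by apply: separable_l; exact: UAU_bounded. Qed.

Let separable_wprob A b : separable (fun t x => wprob A t x b).
Proof.
under eq_fun do under eq_fun do rewrite /wprob sandwichE.
apply: separable_sum => p; apply: separableM; first exact: separable_r.
by apply: separable_l; apply: bounded_mfunM => //; exact: bounded_mfun_conj.
Qed.

(** For fixed [t], left invariance absorbs [U t], so the value does not depend on [t]. *)
Lemma Ex_wprob2 A B t b c : Ex Q (fun x => wprob A t x b * wprob B t x c) =
  moment2_id A B + moment2_swap A B *+ (b == c).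
Proof.
by rewrite /wprob moment2_invariant// (moment2E hW)// !eqxx !andbb.
Qed.

Lemma Ex_wprob A t b : Ex Q (fun x => wprob A t x b) = \tr A / m%:R.
Proof.
have [m0 [m21 mS]] := dimE.
(* The first moment is a second moment against the identity, whose rotated diagonal is constantly
   1. *)
transitivity (Ex Q (fun x => wprob A t x b * wprob 1%:M t x b)).
  congr Ex; apply/funext => x; rewrite /wprob mulmx1 unitaryW mulmx1 unitaryU.
  by rewrite [1%:M _ _]mxE eqxx mulr1.
rewrite Ex_wprob2 eqxx mulr1n /moment2_id /moment2_swap mulmx1 mxtrace1.
by field; rewrite m0 m21.
Qed.

Lemma Ex_prob2 A b :
  Ex P (fun t => prob A t b * prob A t b) = moment2_id A A + moment2_swap A A.
Proof. by rewrite design_moment2 (moment2E hW)// !eqxx. Qed.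

(** Averaging over [W] first gives the same second moment for every outcome; the weights
    [prob A t b] then sum to [\tr A]. *)
Lemma Ex_shadow_obs A B :
  Ex Q (fun x => Ex P (fun t => \sum_b prob A t b * wprob B t x b ^+ 2)) =
  \tr A * (moment2_id B B + moment2_swap B B).
Proof.
have sF : separable (fun t x => \sum_b prob A t b * wprob B t x b ^+ 2).
  by apply: separable_sum => b; apply: separableM => //; exact: separableM.
have [_ _ _ _ ->] := separable_Ex P Q sF.
rewrite -[RHS](Ex_cst P); congr Ex; apply/funext => t.
have sB b : separable (fun t x => wprob B t x b * wprob B t x b).
  exact: separableM.
have bB b : bounded_mfun (fun x => wprob B t x b * wprob B t x b).
  by have [h _ _ _ _] := separable_Ex P Q (sB b); exact: h.
rewrite Ex_sum => [|b]; last first.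
  exact: (bounded_mfunZ _ (bB b)).
rewrite -(sum_prob A t) mulr_suml; apply: eq_bigr => b _.
by rewrite (ExZ Q _ (bB b)) Ex_wprob2 eqxx.
Qed.

(** Averaging over [W] first makes every outcome weight [\tr A / m]; what remains is a second moment
    of [U], given by the design property. *)
Lemma Ex_shadow_state A B :
  Ex Q (fun x => Ex P (fun t => \sum_b wprob A t x b * prob B t b ^+ 2)) =
  \tr A * (moment2_id B B + moment2_swap B B).
Proof.
have [m0 _] := dimE.
have sF : separable (fun t x => \sum_b wprob A t x b * prob B t b ^+ 2).
  by apply: separable_sum => b; apply: separableM => //; exact: separableM.
have [_ _ _ _ ->] := separable_Ex P Q sF.
have bA t b : bounded_mfun (fun x => wprob A t x b).
  by have [h _ _ _ _] := separable_Ex P Q (separable_wprob A b); exact: h.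
transitivity (Ex P (fun t => \sum_b \tr A / m%:R * (prob B t b * prob B t b))).
  congr Ex; apply/funext => t.
  under eq_fun do under eq_bigr do rewrite mulrC.
  rewrite Ex_sum => [|b]; last exact: bounded_mfunZ.
  apply: eq_bigr => b _.
  by rewrite ExZ// Ex_wprob mulrC expr2.
have bB b : bounded_mfun (fun t => prob B t b * prob B t b).
  by apply: bounded_mfunM; exact: UAU_bounded.
rewrite Ex_sum => [|b]; last exact: bounded_mfunZ.
under eq_bigr do rewrite ExZ// Ex_prob2.
by rewrite sumr_const card_ord -mulr_natl; field.
Qed.

(** In the expanded square, the identity part of the [W] average multiplies the squared sum of
    [prob B], that is [\tr B ^+ 2], while the swap part keeps only equal outcomes and leaves second
    moments of [U]. It serves both averages, with the roles of state and observable exchanged. *)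
Lemma Ex_thrifty A B :
  Ex Q (fun x => Ex P (fun t => (\sum_b wprob A t x b * prob B t b) ^+ 2)) =
  moment2_id A A * \tr B ^+ 2 +
  moment2_swap A A * (m%:R * (moment2_id B B + moment2_swap B B)).
Proof.
have sF : separable (fun t x => (\sum_b wprob A t x b * prob B t b) ^+ 2).
  have s1 : separable (fun t x => \sum_b wprob A t x b * prob B t b).
    by apply: separable_sum => b; exact: separableM.
  exact: separableM.
have [_ _ _ _ ->] := separable_Ex P Q sF.
have bA t b : bounded_mfun (fun x => wprob A t x b).
  by have [h _ _ _ _] := separable_Ex P Q (separable_wprob A b); exact: h.
have bAA t b c : bounded_mfun (fun x => wprob A t x b * wprob A t x c).
  exact: bounded_mfunM.
have bcAA t b c (z : C) :
    bounded_mfun (fun x => z * (wprob A t x b * wprob A t x c)).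
  exact: bounded_mfunZ.
have bB b : bounded_mfun (fun t => prob B t b * prob B t b).
  by apply: bounded_mfunM; exact: UAU_bounded.
transitivity (Ex P (fun t => moment2_id A A * \tr B ^+ 2 +
    moment2_swap A A * \sum_b prob B t b * prob B t b)).
  congr Ex; apply/funext => t.
  under eq_fun => x.
    rewrite expr2 big_distrlr /=.
    under eq_bigr => b _ do under eq_bigr => c _ do rewrite mulrACA mulrC.
    over.
  rewrite Ex_sum => [|b]; last exact: bounded_mfun_sum.
  under eq_bigr => b _.
    rewrite Ex_sum => [|c]; last exact: bcAA.
    under eq_bigr do rewrite ExZ// Ex_wprob2 mulrDr mulrnAr.
    rewrite big_split /= sum_delta.
    over.
  rewrite big_split /= -mulr_suml; congr (_ + _); last by rewrite mulrC.
  rewrite -(sum_prob B t) expr2 big_distrlr /= mulr_sumr.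
  by apply: eq_bigr => b _; rewrite -mulr_suml mulrC.
have bSB := bounded_mfun_sum (index_enum 'I_m) xpredT bB.
rewrite (ExD P (bounded_mfun_cst _ _) (bounded_mfunZ _ bSB)) Ex_cst.
rewrite (ExZ P _ bSB).
rewrite (Ex_sum P _ _ bB) (eq_bigr _ (fun b _ => Ex_prob2 B b)).
by rewrite sumr_const card_ord -[_ *+ m]mulr_natl.
Qed.

(** The common shape of all four averages: [c] is the factor [(m + 1)^2] from the inverse channel
    and [g] the squared mean. *)
Lemma Ex_affine (c : C) F g : separable F -> bounded_mfun g ->
  Ex Q (fun x => Ex P (fun t => c * F t x) - g x) =
  c * Ex Q (fun x => Ex P (F^~ x)) - Ex Q g.
Proof.
move=> /(separable_Ex P Q)[_ bF bPF _ _] bg.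
have eF x : Ex P (fun t => c * F t x) - g x = c * Ex P (F^~ x) + -1 * g x.
  by rewrite (ExZ P _ (bF x)) mulN1r.
under eq_fun do rewrite eF.
by rewrite (ExD Q (bounded_mfunZ _ bPF) (bounded_mfunZ _ bg)) !ExZ// mulN1r.
Qed.

Lemma Ex_trace2 A B : Ex Q (fun x => \tr ((W x *m A *m adj (W x)) *m B) ^+ 2) =
  moment2_id A A * \tr B ^+ 2 + moment2_swap A A * \tr (B *m B).
Proof.
by have := haar_trace2 hW A A B B m1; rewrite /= -expr2 => <-.
Qed.

Lemma bounded_mfun_trace A B :
  bounded_mfun (fun x => \tr ((W x *m A *m adj (W x)) *m B) ^+ 2).
Proof.
have h : bounded_mfun (fun x => \tr ((W x *m A *m adj (W x)) *m B)).
  apply: bounded_mfun_sum => i; under eq_fun do rewrite mxE.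
  apply: bounded_mfun_sum => j; apply: bounded_mfunM => //.
  exact: bounded_mfun_cst.
exact: bounded_mfunM.
Qed.

(** * Inversion of the channel and the four averaged variances *)

Context (Minv : 'M[C]_m -> 'M[C]_m).
Context (hMinv : forall X, Minv (meas_channel P U X) = X).

(** The channel maps [(m + 1) X] to [X] when [X] is traceless; apply the left inverse. *)
Lemma Minv_traceless X : \tr X = 0 -> Minv X = (m%:R + 1) *: X.
Proof.
move=> tX; have [_ [_ mS]] := dimE.
rewrite -[RHS]hMinv meas_channelE mxtraceZ tX mulr0 raddf0 addr0.
by rewrite scalerA mulVf// scale1r.
Qed.

Lemma Minv_diag X (V : 'M[C]_m) b : \tr X = 0 ->
  (V *m Minv X *m adj V) b b = (m%:R + 1) * (V *m X *m adj V) b b.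
Proof. by move=> tX; rewrite Minv_traceless// -scalemxAr -scalemxAl mxE. Qed.

Context (rho O : 'M[C]_m) (htrO : \tr O = 0) (htrrho : \tr rho = 1).
Context (hO : hermitian_op O).

Let traceless_orbit x : \tr (W x *m O *m adj (W x)) = 0.
Proof. by rewrite mxtrace_sandwich. Qed.

Let hs_normE : hs_norm2 O = \tr (O *m O). Proof. by rewrite /hs_norm2 hO. Qed.

Lemma shadow_mean_obs :
  Ex Q (fun x => shadow_var P U Minv (W x *m O *m adj (W x)) rho) =
  (1 + (m%:R - \tr (rho *m rho)) / (m%:R ^+ 2 - 1)) * hs_norm2 O.
Proof.
have [m0 [m21 mS]] := dimE.
have sF : separable (fun t x => \sum_b prob rho t b * wprob O t x b ^+ 2).
  by apply: separable_sum => b; apply: separableM => //; exact: separableM.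
have eF x : shadow_var P U Minv (W x *m O *m adj (W x)) rho =
    Ex P (fun t => (m%:R + 1) ^+ 2 * \sum_b prob rho t b * wprob O t x b ^+ 2)
    - \tr (W x *m O *m adj (W x) *m rho) ^+ 2.
  rewrite /shadow_var; congr (Ex _ _ - _); apply/funext => t.
  rewrite mulr_sumr; apply: eq_bigr => b _.
  by rewrite Minv_diag// exprMn mulrCA.
under eq_fun do rewrite eF.
rewrite (Ex_affine _ sF (bounded_mfun_trace O rho)) Ex_shadow_obs Ex_trace2.
rewrite hs_normE /moment2_id /moment2_swap htrO htrrho.
by field; rewrite m0 m21.
Qed.

Lemma shadow_mean_state :
  Ex Q (fun x => shadow_var P U Minv O (W x *m rho *m adj (W x))) =
  (1 + (m%:R - \tr (rho *m rho)) / (m%:R ^+ 2 - 1)) * hs_norm2 O.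
Proof.
have [m0 [m21 mS]] := dimE.
have sF : separable (fun t x => \sum_b wprob rho t x b * prob O t b ^+ 2).
  by apply: separable_sum => b; apply: separableM => //; exact: separableM.
have eF x : shadow_var P U Minv O (W x *m rho *m adj (W x)) =
    Ex P (fun t => (m%:R + 1) ^+ 2 * \sum_b wprob rho t x b * prob O t b ^+ 2)
    - \tr (W x *m rho *m adj (W x) *m O) ^+ 2.
  rewrite /shadow_var [\tr (O *m _)]mxtrace_mulC.
  congr (Ex _ _ - _); apply/funext => t.
  rewrite mulr_sumr; apply: eq_bigr => b _.
  by rewrite Minv_diag// exprMn mulrCA.
under eq_fun do rewrite eF.
rewrite (Ex_affine _ sF (bounded_mfun_trace rho O)) Ex_shadow_state Ex_trace2.
rewrite hs_normE /moment2_id /moment2_swap htrO htrrho.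
by field; rewrite m0 m21.
Qed.

(** The scaled second moment is [m + 1] times the averaged squared mean, so the subtraction leaves
    [m] times the latter and cancels the [m] in its denominator. *)
Lemma thrifty_mean_obs :
  Ex Q (fun x => thrifty_var P U Minv (W x *m O *m adj (W x)) rho) =
  (m%:R * \tr (rho *m rho) - 1) / (m%:R ^+ 2 - 1) * hs_norm2 O.
Proof.
have [m0 [m21 mS]] := dimE.
have sF : separable (fun t x => (\sum_b wprob O t x b * prob rho t b) ^+ 2).
  have s1 : separable (fun t x => \sum_b wprob O t x b * prob rho t b).
    by apply: separable_sum => b; exact: separableM.
  exact: separableM.
have eF x : thrifty_var P U Minv (W x *m O *m adj (W x)) rho =
    Ex P (fun t => (m%:R + 1) ^+ 2 *
      (\sum_b wprob O t x b * prob rho t b) ^+ 2)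
    - \tr (W x *m O *m adj (W x) *m rho) ^+ 2.
  rewrite /thrifty_var; congr (Ex _ _ - _); apply/funext => t.
  rewrite -exprMn mulr_sumr; congr (_ ^+ 2); apply: eq_bigr => b _.
  by rewrite Minv_diag// mulrC mulrA.
under eq_fun do rewrite eF.
rewrite (Ex_affine _ sF (bounded_mfun_trace O rho)) Ex_thrifty Ex_trace2.
rewrite hs_normE /moment2_id /moment2_swap htrO htrrho.
by field; rewrite m0 m21.
Qed.

Lemma thrifty_mean_state :
  Ex Q (fun x => thrifty_var P U Minv O (W x *m rho *m adj (W x))) =
  (m%:R * \tr (rho *m rho) - 1) / (m%:R ^+ 2 - 1) * hs_norm2 O.
Proof.
have [m0 [m21 mS]] := dimE.
have sF : separable (fun t x => (\sum_b wprob rho t x b * prob O t b) ^+ 2).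
  have s1 : separable (fun t x => \sum_b wprob rho t x b * prob O t b).
    by apply: separable_sum => b; exact: separableM.
  exact: separableM.
have eF x : thrifty_var P U Minv O (W x *m rho *m adj (W x)) =
    Ex P (fun t => (m%:R + 1) ^+ 2 *
      (\sum_b wprob rho t x b * prob O t b) ^+ 2)
    - \tr (W x *m rho *m adj (W x) *m O) ^+ 2.
  rewrite /thrifty_var [\tr (O *m _)]mxtrace_mulC.
  congr (Ex _ _ - _); apply/funext => t.
  rewrite -exprMn mulr_sumr; congr (_ ^+ 2); apply: eq_bigr => b _.
  by rewrite Minv_diag// mulrCA.
under eq_fun do rewrite eF.
rewrite (Ex_affine _ sF (bounded_mfun_trace rho O)) Ex_thrifty Ex_trace2.
rewrite hs_normE /moment2_id /moment2_swap htrO htrrho.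
by field; rewrite m0 m21.
Qed.

End Shadows.

(** * Purity of a density operator and positivity of the Hilbert-Schmidt norm *)

Section Purity.
Context (R : realType) (m : nat).
Local Notation C := (R[i]).

(* Positivity is tested on [s e_i - z^* e_j], where [z = rho i j] and
   [s = rho j j]; if [s = 0], on [|z|^2 e_i - (rho i i + 1) z^* e_j]. *)
Lemma psd_minor_le (rho : 'M[C]_m) i j :
  (forall v : 'cV[C]_m, 0 <= (adj v *m rho *m v) 0 0) ->
  rho j i = Num.conj (rho i j) -> rho i j * rho j i <= rho i i * rho j j.
Proof.
move=> psd hij; set z := rho i j in hij *.
have form (a b : C) : 0 <= Num.conj a * a * rho i i + Num.conj a * b * z +
    Num.conj b * a * Num.conj z + Num.conj b * b * rho j j.
  have := psd (a *: delta_mx i 0 + b *: delta_mx j 0).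
  have -> : adj (a *: delta_mx i 0 + b *: delta_mx j 0) =
      Num.conj a *: delta_mx 0 i + Num.conj b *: delta_mx 0 j :> 'rV[C]_m.
    apply/matrixP => k l.
    by rewrite !mxE rmorphD !rmorphM /= !rmorph_nat ![_ && (k == 0)]andbC.
  rewrite mulmxDl !mulmxDr -!scalemxAl -!scalemxAr -!rowE -!colE.
  rewrite ?mulmxDl -?scalemxAl -?rowE !mxE -/z hij.
  by congr (0 <= _); ring.
have ri : 0 <= rho i i.
  by have := form 1 0; rewrite conjC0 conjC1 !(mul0r, mulr0, mul1r, addr0).
have rj : 0 <= rho j j.
  by have := form 0 1; rewrite conjC0 conjC1 !(mul0r, mulr0, mul1r, add0r).
have zz : 0 <= z * Num.conj z by exact: mul_conjC_ge0.
have riJ : Num.conj (rho i i) = rho i i by apply: conj_Creal; exact: ger0_real.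
have rjJ : Num.conj (rho j j) = rho j j by apply: conj_Creal; exact: ger0_real.
rewrite hij; have [s0|s0] := eqVneq (rho j j) 0.
  have wJ : Num.conj (z * Num.conj z) = z * Num.conj z.
    by apply: conj_Creal; exact: ger0_real.
  rewrite s0 mulr0; have := form (z * Num.conj z) (- (rho i i + 1) * Num.conj z).
  rewrite wJ rmorphM rmorphN rmorphD rmorph1 /= riJ conjCK s0 => h.
  rewrite le_eqVlt; apply/orP; left.
  rewrite -sqrf_eq0 eq_le; apply/andP; split; last exact: exprn_ge0.
  (* The form at the chosen vector collapses to this value; as [rho i i + 2] is positive, [|z|^4]
     must vanish. *)
  have : 0 <= (z * Num.conj z) ^+ 2 * (- (rho i i + 2)).
    by apply: le_trans h _; rewrite le_eqVlt; apply/orP; left; apply/eqP; ring.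
  by rewrite mulrN oppr_ge0 pmulr_lle0// ltr_wpDl.
have sp : 0 < rho j j by rewrite lt0r s0 rj.
have := form (rho j j) (- Num.conj z).
rewrite rmorphN /= conjCK rjJ (_ : _ + _ =
  rho j j * (rho i i * rho j j - z * Num.conj z)); last ring.
by rewrite pmulr_rge0// subr_ge0.
Qed.

(** Nonnegativity of the 2 by 2 principal minors bounds the double sum for the purity term by term
    by that for the squared trace, avoiding eigenvalues. *)
Lemma purity_le1 (rho : 'M[C]_m) : density rho -> \tr (rho *m rho) <= 1.
Proof.
move=> [herm psd tr1].
apply: (@le_trans _ _ (\tr rho * \tr rho)); last by rewrite tr1 mulr1.
rewrite [leRHS]big_distrlr /=; apply: ler_sum => i _; rewrite mxE.
apply: ler_sum => j _; apply: psd_minor_le => //.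
by rewrite -adjE herm.
Qed.

Lemma hs_norm2_gt0 (A : 'M[C]_m) : A != 0 -> 0 < hs_norm2 A.
Proof.
move=> A0.
have ge0 i j : 0 <= adj A i j * A j i by rewrite adjE mulrC mul_conjC_ge0.
have -> : hs_norm2 A = \sum_i \sum_j adj A i j * A j i.
  by apply: eq_bigr => i _; rewrite mxE.
rewrite lt0r; apply/andP; split; last by do 2![apply: sumr_ge0 => ? _].
apply: contra A0 => /eqP h; apply/eqP/matrixP => j i; rewrite mxE.
have hi := psumr_eq0P (fun i _ => sumr_ge0 _ (fun j _ => ge0 i j)) h (i := i) isT.
have := psumr_eq0P (fun j _ => ge0 i j) hi (i := j) isT.
by rewrite adjE mulrC => /eqP; rewrite mul_conjC_eq0 => /eqP.
Qed.

End Purity.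

(** * Specialisation to dimension [2 ^ n] and the strict bound on the overhead *)

Theorem theorem1 (R : realType) (n : nat) (hn : (1 <= n)%N)
  (dT : measure_display) (T : measurableType dT) (P : probability T R)
  (U : T -> 'M[R[i]]_(2 ^ n))
  (dS : measure_display) (S : measurableType dS) (Q : probability S R)
  (W : S -> 'M[R[i]]_(2 ^ n))
  (hW : haar Q W) (hU : two_design P U Q W)
  (Minv : 'M[R[i]]_(2 ^ n) -> 'M[R[i]]_(2 ^ n))
  (hMinv : forall X, meas_channel P U (Minv X) = X /\ Minv (meas_channel P U X) = X)
  (rho O : 'M[R[i]]_(2 ^ n))
  (hrho : density rho) (hO : hermitian_op O) (htrO : \tr O = 0) :
  let d : R[i] := (2 ^ n)%N%:R in
  let wp := \tr (rho *m rho) in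
  [/\ Ex Q (fun x => shadow_var P U Minv (W x *m O *m adj (W x)) rho)
        = (1 + (d - wp) / (d ^+ 2 - 1)) * hs_norm2 O,
      Ex Q (fun x => shadow_var P U Minv O (W x *m rho *m adj (W x)))
        = (1 + (d - wp) / (d ^+ 2 - 1)) * hs_norm2 O,
      Ex Q (fun x => thrifty_var P U Minv (W x *m O *m adj (W x)) rho)
        = (d * wp - 1) / (d ^+ 2 - 1) * hs_norm2 O,
      Ex Q (fun x => thrifty_var P U Minv O (W x *m rho *m adj (W x)))
        = (d * wp - 1) / (d ^+ 2 - 1) * hs_norm2 O
    & O != 0 -> (d * wp - 1) / (d ^+ 2 - 1) * hs_norm2 O < hs_norm2 O / d].

Proof.
have m1 : (1 < 2 ^ n)%N by rewrite -(expn0 2) ltn_exp2l.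
have hMinv' X : Minv (meas_channel P U X) = X by case: (hMinv X).
have trrho : \tr rho = 1 by case: hrho.
move=> d wp; split.
- exact: (shadow_mean_obs hW hU m1 hMinv' htrO trrho hO).
- exact: (shadow_mean_state hW hU m1 hMinv' htrO trrho hO).
- exact: (thrifty_mean_obs hW hU m1 hMinv' htrO trrho hO).
- exact: (thrifty_mean_state hW hU m1 hMinv' htrO trrho hO).
(* Both sides vanish at [O = 0], so strictness rests on cancelling a positive norm. *)
move=> /hs_norm2_gt0 O0; rewrite [ltRHS]mulrC ltr_pM2r//.
have d1 : 1 < d by rewrite ltr1n.
have d0 : 0 < d by exact: lt_trans d1.
have dd : 0 < d ^+ 2 - 1 by rewrite subr_gt0 expr_gt1// ltW.
rewrite ltr_pdivrMr// mulrBr mulr1 expr2 mulKf ?gt_eqF//.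
(* The goal is now [d wp - 1 < d - 1/d]: purity at most 1 gives the first half, [1 < d] the strict
   second half. *)
apply: (@le_lt_trans _ _ (d - 1)).
  by rewrite lerD2r ler_piMr ?(ltW d0)//; exact: purity_le1.
by rewrite ltrD2l ltrN2 invf_lt1.
Qed.
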